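(* Let $X,Y$ be real topological vector spaces, let $\rho:X\to\mathbb{R}$ and $\sigma:Y\to\mathbb{R}$ be continuous linear functionals, and let $K:\mathbb{G}_{\rho}(X)\to\mathbb{G}_{\sigma}(Y)$ be a continuous function satisfying $$K(x\circ_{\rho}y)=K(x)\circ_{\sigma}K(y)\qquad(x,y\in\mathbb{G}_{\rho}(X))$$ and $$K(\mathcal{N}(\rho))\subseteq\mathcal{N}(\sigma).$$ Then $K|\mathcal{N}(\rho)$ is linear, and either (i) $K$ is linear, or (ii) for any $u$ with $\rho(u)=1$, $\pi_{u}(x):=x-\rho(x)u$ is the projection onto $\mathcal{N}(\rho)$ parallel to $u$ and $$K(x)=\begin{cases}K(\pi_{u}(x))+K(u)\,[(1+\rho(x))^{\log(1+\tau)/\log 2}-1]/\tau, & \tau\neq 0,\\ K(\pi_{u}(x))+K(u)\log(1+\rho(x))/\log 2, & \tau=0,\end{cases}$$ for $\tau=\sigma(K(u))$. In particular, $x\mapsto K(\pi_{u}(x))$ is linear.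
   Context: For a real topological vector space $X$ and a continuous linear functional $\rho:X\to\mathbb{R}$, put $\eta_{\rho}(x):=1+\rho(x)$ and $x\circ_{\rho}y:=x+y\,\eta_{\rho}(x)=x+y+\rho(x)y$. The Popa group is $\mathbb{G}_{\rho}(X):=\{x\in X:1+\rho(x)>0\}$, which is a group under $\circ_{\rho}$ (neutral element $0$, inverse of $x$ equal to $-x/(1+\rho(x))$), with the subspace topology. $\mathbb{G}_{\sigma}(Y)$ and $\circ_\sigma$ are defined likewise from a continuous linear functional $\sigma:Y\to\mathbb{R}$. $\mathcal{N}(\rho)=\{x:\rho(x)=0\}$ denotes the null space of $\rho$, and similarly $\mathcal{N}(\sigma)$.
   Formalization: The space Y is assumed to be Hausdorff (part of many definitions of a topological vector space); without it the claim fails, e.g. X = ℝ, ρ = 0, σ = 0, Y = ℝ with the indiscrete topology and K a nonlinear additive map. *)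

(* Defs.v *)
From HB Require Import structures.
From mathcomp Require Import all_boot all_order all_algebra.
From mathcomp Require Import all_classical all_reals all_analysis.

Set Implicit Arguments.
Unset Strict Implicit.
Unset Printing Implicit Defensive.

Import Order.TTheory GRing.Theory Num.Theory.
Import numFieldTopology.Exports.

Local Open Scope classical_set_scope.
Local Open Scope ring_scope.

(* A real topological vector space is a [topologicalLmodType R], which is not
   assumed to be locally convex or Hausdorff. *)

Section Popa.
Context (R : realType) (X : topologicalLmodType R) (rho : {scalar X}).

Definition popa_eta (x : X) : R := 1 + rho x.

Definition popa_op (x y : X) : X := x + popa_eta x *: y.

Definition popa_group : set X := [set x | 0 < popa_eta x].

Definition null_space : set X := [set x | rho x = 0].

Definition popa_proj (u x : X) : X := x - rho x *: u.

End Popa.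

Section Linearity.
Context (R : realType) (X Y : lmodType R).

(* Only meant for a linear subspace M: [f] restricted to M is linear. *)
Definition linear_on_subspace (M : set X) (f : X -> Y) : Prop :=
  forall (a : R) (x y : X), M x -> M y -> f (a *: x + y) = a *: f x + f y.

(* For a set A that need not be a subspace (such as a Popa group): on A,
   [f] agrees with a linear map defined on the whole space. *)
Definition linear_restriction (A : set X) (f : X -> Y) : Prop :=
  exists L : {linear X -> Y}, forall x, A x -> f x = L x.

(* [p] is the projection onto M parallel to the direction [u]. *)
Definition is_projection_along (M : set X) (u : X) (p : X -> X) : Prop :=
  [/\ linear p, forall x, p (p x) = p x, range p = M
    & p @^-1` [set 0] = range (fun t : R => t *: u)].

End Linearity.

(* A map between Popa groups is represented by a total function K : X -> Y
   whose values outside the domain group are irrelevant: [K] maps the domain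
   group into the target group and is continuous there for the subspace
   topology. *)
Definition continuous_popa_map (R : realType) (X Y : topologicalLmodType R)
    (rho : {scalar X}) (sigma : {scalar Y}) (K : X -> Y) : Prop :=
  (forall x, popa_group rho x -> popa_group sigma (K x)) /\
  {within popa_group rho, continuous K}.

(* Main.v *)
Require Import Defs.
From HB Require Import structures.
From mathcomp Require Import all_boot all_order all_algebra.
From mathcomp Require Import all_classical all_reals all_analysis.
From mathcomp Require Import ring.
Import Order.TTheory GRing.Theory Num.Theory.
Import numFieldTopology.Exports.
Local Open Scope classical_set_scope.
Local Open Scope ring_scope.

(** On [null_space rho] both Popa operations reduce to addition, and each
    [x] in [popa_group rho] factors as [popa_proj rho u x] times the point
    [rho x *: u] of the ray through [u].  Hence [K] is determined by its
    additive restriction to the null space and by the one-parameter subgroup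
    [t |-> K ((expR t - 1) *: u)] of the target group.  For a one-parameter
    subgroup [F], the function [1 + sigma (F t)] is a continuous homomorphism
    into the positive reals, hence an exponential; commutativity of the
    parameter group then forces [sigma (F t) *: F c = sigma (F c) *: F t],
    which gives [F] when [sigma (F c) != 0]; otherwise [F] is additive.

    The formula of (ii) holds for every [u] with [rho u = 1] in all cases, so
    alternative (i) is subsumed by (ii), which is vacuous when [rho = 0]. *)

Lemma add_fun_continuous (T : topologicalType) (V : topologicalZmodType)
    (f g : T -> V) :
  continuous f -> continuous g -> continuous (fun x => f x + g x).
Proof.
move=> cf cg x.
apply: (@continuous_comp _ _ _ (fun y => (f y, g y)) (fun z => z.1 + z.2)).
  by apply: cvg_pair; [exact: cf|exact: cg].
exact: add_continuous.
Qed.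

(** The scalar factor is typed in [R^o], the topological module on which [scale_continuous] is
    stated. *)
Lemma scale_fun_continuous (R : realType) (T : topologicalType)
    (V : topologicalLmodType R) (a : T -> R) (v : V) :
  continuous a -> continuous (fun x => a x *: v).
Proof.
move=> ca x.
apply: (@continuous_comp _ (R^o * V)%type _ (fun y => (a y, v))
  (fun z => z.1 *: z.2)).
  by apply: (@cvg_pair _ _ _ _ (nbhs (a x : R^o))); [exact: ca|exact: cvg_cst].
exact: scale_continuous.
Qed.

Lemma additive_rat_homog (R : realType) (V : lmodType R) (g : {additive R -> V})
    (q : rat) :
  g (ratr q) = ratr q *: g 1.
Proof.
have d0 : (denq q)%:~R != 0 :> R by rewrite intr_eq0 denq_neq0.
apply: (scalerI d0); rewrite scaler_int -(raddfMz g) scalerA.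
have -> : (denq q)%:~R * ratr q = (numq q)%:~R :> R.
  by rewrite /ratr mulrC mulfVK.
by rewrite scaler_int -(raddfMz g) -[ratr q *~ _]mulrzr /ratr divfK.
Qed.

(** Additivity settles rational arguments; density and continuity carry this to the reals. The
    reference point [c] is left free for later reparametrisation. *)
Lemma additive_continuous_homog (R : realType) (V : topologicalLmodType R)
    (g : R -> V) :
  hausdorff_space V -> {morph g : s t / s + t} -> continuous g ->
  forall c t, c != 0 -> g t = (t / c) *: g c.
Proof.
move=> hV gD cg.
suff g1 t : g t = t *: g 1.
  by move=> c t c0; rewrite (g1 t) (g1 c) scalerA divfK.
have g0 : g 0 = 0 by apply: (addrI (g 0)); rewrite -gD !addr0.
pose ga := GRing.isNmodMorphism.Build _ _ g (conj g0 gD).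
pose G : {additive R -> V} := HB.pack g ga.
apply: contrapT => gt.
(* [h] is the defect from homogeneity. Since [[set 0]] is closed in a Hausdorff space, [h] is
   nonzero on an open set, which would contain a rational if nonempty. *)
pose h s := g s + s *: - g 1.
have ch : continuous h.
  by apply: add_fun_continuous => //; apply: scale_fun_continuous => x; exact: cvg_id.
have oh : open (h @^-1` ~` [set 0]).
  apply: open_comp; first by move=> x _; exact: ch.
  by rewrite openC; apply: accessible_closed_set1; exact: hausdorff_accessible.
have /(dense_rat)/(_ oh)[r [hr [q _ qE]]] : (h @^-1` ~` [set 0]) !=set0.
  by exists t => /=; rewrite /h scalerN => /eqP; rewrite subr_eq0 => /eqP.
by apply: hr; rewrite /= /h -qE [g _](additive_rat_homog _ _ G) scalerN subrr.
Qed.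

Lemma popa_eta_op (R : realType) (X : topologicalLmodType R) (rho : {scalar X})
    (x y : X) :
  popa_eta rho (popa_op rho x y) = popa_eta rho x * popa_eta rho y.
Proof. by rewrite /popa_op /popa_eta linearD linearZ /=; ring. Qed.

Lemma popa_eta_continuous (R : realType) (X : topologicalLmodType R)
    (rho : {scalar X}) :
  continuous rho -> continuous (popa_eta rho).
Proof. by move=> cr; apply: add_fun_continuous => // x; exact: cvg_cst. Qed.

Lemma popa_group_open (R : realType) (X : topologicalLmodType R)
    (rho : {scalar X}) :
  continuous rho -> open (popa_group rho).
Proof.
move=> cr; apply: (@open_comp _ _ (popa_eta rho) [set x | 0 < x]).
  by move=> x _; exact: popa_eta_continuous.
exact: open_gt.
Qed.

Lemma null_space_popa_group (R : realType) (X : topologicalLmodType R)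
    (rho : {scalar X}) :
  null_space rho `<=` popa_group rho.
Proof. by move=> x nx; rewrite /popa_group /= /popa_eta nx addr0. Qed.

Lemma popa_op_null (R : realType) (X : topologicalLmodType R)
    (rho : {scalar X}) (x y : X) :
  null_space rho x -> popa_op rho x y = x + y.
Proof. by move=> nx; rewrite /popa_op /popa_eta nx addr0 scale1r. Qed.

Section OneParameterSubgroup.
Context (R : realType) (Y : topologicalLmodType R) (sigma : {scalar Y}).
Context (F : R -> Y).
Hypotheses (hausY : hausdorff_space Y) (sigma_cont : continuous sigma).
Hypotheses (F_cont : continuous F) (F_pos : forall t, popa_group sigma (F t)).
Hypothesis F_hom : forall s t, F (s + t) = popa_op sigma (F s) (F t).

(** The logarithm of [popa_eta sigma] along [F] is additive and continuous, hence linear. *)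
Lemma one_parameter_eta c t : c != 0 ->
  popa_eta sigma (F t) = expR (t / c * ln (popa_eta sigma (F c))).
Proof.
move=> c0; pose g s : R := ln (popa_eta sigma (F s)).
have gD : {morph g : s t / s + t}.
  by move=> s s'; rewrite /g F_hom popa_eta_op lnM // posrE; exact: F_pos.
have cg : continuous g.
  move=> s; apply: (@continuous_comp _ _ _ (popa_eta sigma \o F) (@ln R)).
    by apply: continuous_comp; [exact: F_cont|exact: popa_eta_continuous].
  by apply: continuous_ln; exact: F_pos.
have hR : hausdorff_space R by exact: order_hausdorff.
have := additive_continuous_homog _ _ _ hR gD cg c t c0.
rewrite /g => /(congr1 (@expR R)); rewrite lnK ?posrE //; exact: F_pos.
Qed.

(** Expand [F (s + t)] and [F (t + s)] and cancel the common [F s + F t]. *)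
Lemma one_parameter_comm s t : sigma (F s) *: F t = sigma (F t) *: F s.
Proof.
have := F_hom s t; rewrite addrC F_hom /popa_op /popa_eta !scalerDl !scale1r.
by rewrite addrCA => /addrI/addrI ->.
Qed.

Lemma one_parameterE c t : c != 0 ->
  F t = if sigma (F c) != 0
        then ((expR (t / c * ln (1 + sigma (F c))) - 1) / sigma (F c)) *: F c
        else (t / c) *: F c.
Proof.
move=> c0; have eta_t s := one_parameter_eta c s c0.
case: ifPn => [tau0|/negPn/eqP tau0].
  apply: (scalerI tau0); rewrite one_parameter_comm scalerA mulrC divfK //.
  by congr (_ *: _); rewrite -[expR _]eta_t /popa_eta addrC addKr.
have etaF s : popa_eta sigma (F s) = 1.
  by rewrite eta_t /popa_eta tau0 addr0 ln1 mulr0 expR0.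
apply: additive_continuous_homog => // s s'.
by rewrite F_hom /popa_op etaF scale1r.
Qed.

End OneParameterSubgroup.

Section PopaHomomorphism.
Context (R : realType) (X Y : topologicalLmodType R).
Context (rho : {scalar X}) (sigma : {scalar Y}) (K : X -> Y).
Hypotheses (hausY : hausdorff_space Y).
Hypotheses (rho_cont : continuous rho) (sigma_cont : continuous sigma).
Hypothesis K_cont : continuous_popa_map rho sigma K.
Hypothesis K_hom : forall x y : X, popa_group rho x -> popa_group rho y ->
  K (popa_op rho x y) = popa_op sigma (K x) (K y).
Hypothesis K_null : K @` null_space rho `<=` null_space sigma.

(** [K] is continuous only within the Popa group, but that group is open, so [K] is continuous at
    each of its points. *)
Lemma popa_map_comp_continuous (f : R -> X) :
  continuous f -> (forall t, popa_group rho (f t)) -> continuous (K \o f).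
Proof.
move=> cf fG t; apply: continuous_comp; first exact: cf.
case: K_cont => _; rewrite continuous_open_subspace; last exact: popa_group_open.
by apply; rewrite inE; exact: fG.
Qed.

Lemma popa_hom_null_add (n y : X) : null_space rho n -> popa_group rho y ->
  K (n + y) = K n + K y.
Proof.
move=> Nn Gy; rewrite -(@popa_op_null _ _ rho) // K_hom ?popa_op_null //.
  by apply: K_null; exists n.
exact: null_space_popa_group.
Qed.

(** The line [t *: n] is a one-parameter subgroup, and [K_null] puts its image in the degenerate
    case of [one_parameterE], taken at [c = 1]. *)
Lemma popa_hom_null_homog (a : R) (n : X) : null_space rho n ->
  K (a *: n) = a *: K n.
Proof.
move=> Nn; have NZ s : null_space rho (s *: n).
  by rewrite /null_space /= linearZ /= Nn mulr0.
have GZ s := null_space_popa_group _ _ _ _ (NZ s).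
have Kn0 : sigma (K (1 *: n)) = 0 by apply: K_null; exists (1 *: n).
have := @one_parameterE _ _ sigma (fun t => K (t *: n)) hausY sigma_cont
  _ _ _ 1 a (oner_neq0 R).
rewrite Kn0 eqxx divr1 scale1r; apply.
- apply: (@popa_map_comp_continuous (fun t => t *: n)) => //.
  by apply: scale_fun_continuous => x; exact: cvg_id.
- by move=> t; apply: K_cont.1.
- by move=> s t; rewrite scalerDl -K_hom // popa_op_null.
Qed.

Lemma popa_hom_null_linear : linear_on_subspace (null_space rho) K.
Proof.
move=> a x y Nx Ny; rewrite popa_hom_null_add ?popa_hom_null_homog //.
  by rewrite /null_space /= linearZ /= Nx mulr0.
exact: null_space_popa_group.
Qed.

Lemma popa_hom_ray (u : X) (s : R) : rho u = 1 -> 0 < 1 + s ->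
  K (s *: u) = if sigma (K u) != 0
    then (((1 + s) `^ (ln (1 + sigma (K u)) / ln 2) - 1) / sigma (K u)) *: K u
    else (ln (1 + s) / ln 2) *: K u.
Proof.
(* This parametrisation makes [popa_eta rho (f t)] equal to [expR t], so [f] turns addition into
   [popa_op rho]. *)
move=> ru s0; pose f t : X := (expR t - 1) *: u.
have etaf t : popa_eta rho (f t) = expR t.
  by rewrite /popa_eta linearZ /= ru mulr1 addrC subrK.
have Gf t : popa_group rho (f t) by rewrite /popa_group /= etaf expR_gt0.
have fln t : 0 < 1 + t -> f (ln (1 + t)) = t *: u.
  by move=> t0; rewrite /f lnK ?posrE // addrC addKr.
have ln2 : ln 2 != 0 :> R by rewrite gt_eqF // ln_gt0 // ltr1n.
(* The ray passes through [u] at time [ln 2]; this is the source of [ln 2] in the formula. *)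
have f2 : f (ln 2) = u.
  by rewrite -[2]/(1 + 1) fln ?scale1r // ltr0n.
have cf : continuous (K \o f).
  apply: popa_map_comp_continuous => //; apply: scale_fun_continuous.
  by apply: add_fun_continuous => x; [exact: continuous_expR|exact: cvg_cst].
have Ff a b : (K \o f) (a + b) = popa_op sigma ((K \o f) a) ((K \o f) b).
  rewrite /= -K_hom // /popa_op etaf /f scalerA -scalerDl expRD.
  by congr (K (_ *: _)); ring.
have := one_parameterE _ _ _ _ hausY sigma_cont cf
  (fun t => K_cont.1 _ (Gf t)) Ff (ln 2) (ln (1 + s)) ln2.
(* As [1 + s] is nonzero, [powR] is a plain exponential, and the exponents agree up to reordering
   factors. *)
rewrite /= fln // f2 /powR (gt_eqF s0) => ->.
by rewrite [_ / ln 2 * ln _]mulrAC [ln _ * ln _]mulrC mulrAC.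
Qed.

End PopaHomomorphism.

Lemma popa_proj_null (R : realType) (X : topologicalLmodType R)
    (rho : {scalar X}) (u x : X) :
  rho u = 1 -> null_space rho (popa_proj rho u x).
Proof.
by move=> ru; rewrite /null_space /popa_proj /= linearB linearZ /= ru mulr1 subrr.
Qed.

Lemma popa_proj_linear (R : realType) (X : topologicalLmodType R)
    (rho : {scalar X}) (u : X) :
  linear (popa_proj rho u).
Proof.
move=> a x y; rewrite /popa_proj linearP scalerDl scalerBr scalerA opprD.
by rewrite addrACA.
Qed.

Lemma popa_proj_is_projection (R : realType) (X : topologicalLmodType R)
    (rho : {scalar X}) (u : X) :
  rho u = 1 -> is_projection_along (null_space rho) u (popa_proj rho u).
Proof.
move=> ru; have projN x : null_space rho x -> popa_proj rho u x = x.
  by move=> Nx; rewrite /popa_proj Nx scale0r subr0.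
split.
- exact: popa_proj_linear.
- by move=> x; rewrite projN //; exact: popa_proj_null.
- apply/seteqP; split=> [_ [x _ <-]|x Nx]; first exact: popa_proj_null.
  by exists x => //; exact: projN.
- apply/seteqP; split=> [x /= /eqP|_ [t _ <-]] /=.
    by rewrite subr_eq0 => /eqP ->; exists (rho x).
  by rewrite /popa_proj (linearZ_LR rho) /= ru mulr1 subrr.
Qed.

Theorem mainTheorem1 (R : realType) (X Y : topologicalLmodType R)
  (hausY : hausdorff_space Y)
  (rho : {scalar X}) (sigma : {scalar Y})
  (rho_cont : continuous rho) (sigma_cont : continuous sigma)
  (K : X -> Y) (K_cont : continuous_popa_map rho sigma K)
  (K_hom : forall x y : X, popa_group rho x -> popa_group rho y ->
     K (popa_op rho x y) = popa_op sigma (K x) (K y))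
  (K_null : K @` null_space rho `<=` null_space sigma) :
  linear_on_subspace (null_space rho) K /\
  (linear_restriction (popa_group rho) K \/
   forall u : X, rho u = 1 ->
     let tau := sigma (K u) in
     [/\ is_projection_along (null_space rho) u (popa_proj rho u),
       forall x : X, popa_group rho x ->
         K x = if tau != 0
               then K (popa_proj rho u x) +
                    (((1 + rho x) `^ (ln (1 + tau) / ln 2) - 1) / tau) *: K u
               else K (popa_proj rho u x) + (ln (1 + rho x) / ln 2) *: K u
       & linear (fun x : X => K (popa_proj rho u x))]).
Proof.
have K_lin : linear_on_subspace (null_space rho) K.
  exact: (popa_hom_null_linear _ _ _ _ sigma).
split=> //; right=> u ru tau.
have projN x := @popa_proj_null _ _ rho u x ru.
split.
- exact: popa_proj_is_projection.
- move=> x Gx.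
  (* The ray component has the same [popa_eta rho] as [x], so it stays in the group. *)
  have Gr : popa_group rho (rho x *: u).
    by rewrite /popa_group /= /popa_eta linearZ /= ru mulr1.
  have {1}-> : x = popa_proj rho u x + rho x *: u by rewrite subrK.
  rewrite (@popa_hom_null_add _ _ _ rho sigma) //.
  rewrite (@popa_hom_ray _ _ _ rho sigma) // -/tau.
  by case: ifP.
- by move=> a x y; rewrite popa_proj_linear K_lin.
Qed.
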